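(* Let $(M_n,S_n)_{n\ge0}$ be a Markov random walk with positive recurrent driving chain on the countable state space $\mathcal{S}$. For any fixed $i\in\mathcal{S}$, let $(\sigma(n))_{n\ge1}$ be the (possibly defective) sequence of strictly ascending ladder epochs of the embedded random walk $(S_{\tau_n(i)})_{n\ge0}$ under $\mathbb{P}_i$. Then $$\mathbb{P}_i(M_n=i,\,S_n>0)=\sum_{k\ge1}\frac{n}{k}\,\mathbb{E}_i\left(\frac{\sigma(k)}{\tau_{\sigma(k)}(i)}\mathbf{1}_{\{\tau_{\sigma(k)}(i)=n\}}\right)$$ for all $n\in\mathbb{N}$.
   Context: Markov random walk (MRW): $\mathbf{M}=(M_n)_{n\ge0}$ (the driving chain) is a positive recurrent Markov chain on a countable state space $\mathcal{S}$ with unique stationary distribution $\pi=(\pi_i)_{i\in\mathcal{S}}$ (so it is irreducible). $S_0=0$, $S_n=\sum_{l=1}^n X_l$, where the real random variables $X_1,X_2,\dots$ are conditionally independent given $\mathbf{M}$ and, for a stochastic kernel $K$ from $\mathcal{S}^2$ to $\mathbb{R}$, $\mathbb{P}((X_1,\dots,X_n)\in\cdot\mid M_0=i_0,\dots,M_n=i_n)=K_{i_0i_1}\otimes\dots\otimes K_{i_{n-1}i_n}$ for all $n\ge1$ and $i_0,\dots,i_n\in\mathcal{S}$. $\mathbb{P}_i:=\mathbb{P}(\cdot\mid M_0=i)$, with expectation $\mathbb{E}_i$. $\tau_0(i):=0$ and $(\tau_n(i))_{n\ge1}$ is the sequence of successive return epochs of $\mathbf{M}$ to $i$ (at times $\ge1$).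 Strictly ascending ladder epochs: $\sigma(0):=0$ and, for $k\ge1$, $\sigma(k):=\inf\{m>\sigma(k-1):S_{\tau_m(i)}>S_{\tau_{\sigma(k-1)}(i)}\}$, with $\sigma(k)=\infty$ if $\sigma(k-1)=\infty$ or no such $m$ exists (defectiveness); on $\{\sigma(k)=\infty\}$ one has $\tau_{\sigma(k)}(i)=\infty$, so the indicator in the formula vanishes there. *)

(* Defs.v *)
From HB Require Import structures.
From mathcomp Require Import all_boot all_order all_algebra.
From mathcomp Require Import all_classical all_reals all_analysis.

Set Implicit Arguments.
Unset Strict Implicit.
Unset Printing Implicit Defensive.

Import Order.TTheory GRing.Theory Num.Theory.

Local Open Scope classical_set_scope.
Local Open Scope ring_scope.

(** Random epochs take values in [option nat], [None] standing for infinity. *)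

Definition first_time (A : pred nat) : option nat :=
  match pselect (exists n, A n) with
  | left e => Some (ex_minn e)
  | right _ => None
  end.

Definition ereal_of_time {R : realType} (t : option nat) : \bar R :=
  if t is Some n then n%:R%:E else +oo%E.

(* The value 0 at infinity is a dummy: [real_of_time] is only meant to be used
   multiplied by the indicator of a set on which the epoch is finite. *)
Definition real_of_time {R : realType} (t : option nat) : R :=
  if t is Some n then n%:R else 0.

Section cond_prob.
Context {d : measure_display} {T : measurableType d} {R : realType}.

(* Only meaningful when [P B != 0]. *)
Definition cond_prob (P : probability T R) (A B : set T) : \bar R :=
  (P (A `&` B) / P B)%E.

End cond_prob.

Section markov_chain.
Context {R : realType} {S : countType}.

Definition stochastic_matrix (p : S -> S -> R) : Prop :=
  (forall i j, 0 <= p i j) /\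
  (forall i, \esum_(j in [set: S]) (p i j)%:E = 1%E).

Definition stationary_distribution (p : S -> S -> R) (pi : S -> R) : Prop :=
  [/\ forall i, 0 <= pi i,
      \esum_(i in [set: S]) (pi i)%:E = 1%E &
      forall j, \esum_(i in [set: S]) (pi i * p i j)%:E = (pi j)%:E].

Definition unique_stationary_distribution (p : S -> S -> R) (pi : S -> R) :
    Prop :=
  stationary_distribution p pi /\
  (forall pi', stationary_distribution p pi' -> pi' = pi).

Context {d : measure_display} {T : measurableType d}.
Implicit Types (P : probability T R) (M : nat -> T -> S).

Definition path_event M (n : nat) (x : nat -> S) : set T :=
  [set w | forall k, (k <= n)%N -> M k w = x k].

Definition markov_chain P (p : S -> S -> R) M : Prop :=
  (forall n j, measurable [set w | M n w = j]) /\
  (forall n x, P (path_event M n x) != 0%E ->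
     cond_prob P [set w | M n.+1 w = x n.+1] (path_event M n x)
     = (p (x n) (x n.+1))%:E).

Fixpoint return_epoch M (i : S) (n : nat) (w : T) : option nat :=
  if n is n'.+1 then
    obind (fun t => first_time [pred m | (t < m)%N && (M m w == i)])
          (return_epoch M i n' w)
  else Some 0%N.

(* [P i] is the law under which the chain starts in [i]. *)
Definition positive_recurrent (P : S -> probability T R) M : Prop :=
  forall i, P i [set w | return_epoch M i 1 w != None] = 1%E /\
    (\int[P i]_w ereal_of_time (return_epoch M i 1 w) < +oo)%E.

End markov_chain.

Section markov_random_walk.
Context {R : realType} {S : countType}.
Context {d : measure_display} {T : measurableType d}.
Implicit Types (M : nat -> T -> S) (X : nat -> T -> R).

(* The product of the K_{x_{l-1} x_l} is determined by its values on measurable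
   rectangles B_1 x ... x B_n; [X 0] plays no role. *)
Definition conditional_increments (P : probability T R)
    (K : S -> S -> probability (measurableTypeR R) R) M X : Prop :=
  (forall n, measurable_fun [set: T] (X n)) /\
  (forall (n : nat) (x : nat -> S) (B : nat -> set (measurableTypeR R)),
     (0 < n)%N -> (forall l, measurable (B l)) ->
     P (path_event M n x) != 0%E ->
     cond_prob P [set w | forall l, (1 <= l <= n)%N -> B l (X l w)]
               (path_event M n x)
     = (\prod_(1 <= l < n.+1) K (x l.-1) (x l) (B l))%E).

(* The family [P i], for i in S, consists of the laws of one and the same
   process given that the driving chain starts in [i]. *)
Record markov_random_walk (P : S -> probability T R) (p : S -> S -> R)
    (K : S -> S -> probability (measurableTypeR R) R) M X : Prop := {
  mrw_stochastic : stochastic_matrix p;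
  mrw_start : forall i, P i [set w | M 0%N w = i] = 1%E;
  mrw_chain : forall i, markov_chain (P i) p M;
  mrw_increments : forall i, conditional_increments (P i) K M X
}.

Definition walk X (n : nat) (w : T) : R := \sum_(1 <= l < n.+1) X l w.

(* The comparison fails if one of the two return epochs is infinite. *)
Definition embedded_walk_lt M X (i : S) (a b : nat) (w : T) : bool :=
  match return_epoch M i a w, return_epoch M i b w with
  | Some s, Some t => walk X s w < walk X t w
  | _, _ => false
  end.

Fixpoint ladder_epoch M X (i : S) (k : nat) (w : T) : option nat :=
  if k is k'.+1 then
    obind (fun s => first_time
             [pred m | (s < m)%N && embedded_walk_lt M X i s m w])
          (ladder_epoch M X i k' w)
  else Some 0%N.

Definition return_epoch_at_ladder M X (i : S) (k : nat) (w : T) : option nat :=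
  obind (fun s => return_epoch M i s w) (ladder_epoch M X i k w).

End markov_random_walk.

(* Main.v *)
Require Import Defs.
From HB Require Import structures.
From mathcomp Require Import all_boot all_order all_algebra.
From mathcomp Require Import all_classical all_reals all_analysis.
From mathcomp Require Import measurable_realfun.

Set Implicit Arguments.
Unset Strict Implicit.
Unset Printing Implicit Defensive.

Import Order.TTheory GRing.Theory Num.Theory.

Local Open Scope classical_set_scope.
Local Open Scope ring_scope.

(** The formula is a cycle lemma averaged over the bridges of the Markov random
    walk from i to i of length n.

    Read at the level of times, the event that the return epoch of index
    sigma(k) equals n says that n is a visit to i, that S_n exceeds S at all
    earlier visits, and that exactly k times in (0, n] are such records
    ([return_epoch_at_ladderP]).  On this event sigma(k) is the number of visits
    to i in (0, n], so that, for n > 0, the k-th term of the series is 1/k times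
    the sum, over the times n - s with 0 <= s < n, of the probability that the
    event occurs and the chain is in i at time n - s ([expectation_ladder]).

    Reading a bridge cyclically from one of its visits to i does not change its
    law: the probability of a cycle of states is a product over its edges, and
    so is the conditional law of the increments, whence the two laws agree on
    rectangles, hence everywhere ([probability_path_shift]).  Rotation by s
    carries the visit at time s to time 0 and the visit at time 0 to time n - s
    ([bridge_shift]).  This mass transport
    replaces the sum over the visits n - s of one fixed event by the sum over the
    visits s of the event for the bridge started at s.

    For a single bridge that last sum is evaluated by [cycle_lemma].  If
    S_n > 0, the bridge continued periodically has the same number r >= 1 of
    all-time records in each period.  The bridge started at the visit s ends at
    a record exactly when s is (modulo n) such an all-time record, and it then
    has r records.  Weighting by 1/r, the r good starting points contribute 1
    altogether.  If S_n <= 0, no starting point is good.  So the sum is the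
    indicator of S_n > 0, and integrating it gives the left-hand side
    ([sum_ladder_bridge]).

    All arguments concern the finite horizon n, and the sum over paths is a sum
    over the countable set of maps from {0, ..., n - 1} to the state space. *)

(** * Counting times and records *)

Definition nb_upto (A : pred nat) (t : nat) : nat := \sum_(1 <= u < t.+1) A u.

Lemma nb_upto0 A : nb_upto A 0 = 0%N.
Proof. by rewrite /nb_upto big_geq. Qed.

Lemma nb_uptoS A t : nb_upto A t.+1 = (nb_upto A t + A t.+1)%N.
Proof. by rewrite /nb_upto big_nat_recr. Qed.

Lemma nb_upto_le A t : (nb_upto A t <= t)%N.
Proof.
elim: t => [|t IH]; first by rewrite nb_upto0.
by rewrite nb_uptoS -addn1 leq_add// leq_b1.
Qed.

Lemma nb_upto_gt0 (A : pred nat) t : (0 < t)%N -> A t -> (0 < nb_upto A t)%N.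
Proof. by case: t => // t _ At; rewrite nb_uptoS At addn1. Qed.

Lemma nb_upto_homo A : {homo nb_upto A : s t / (s <= t)%N}.
Proof.
move=> s t st; rewrite /nb_upto [leqRHS](big_cat_nat (n := s.+1))//=.
exact: leq_addr.
Qed.

Lemma nb_upto_ltn (A : pred nat) s t :
  (s < t)%N -> A t -> (nb_upto A s < nb_upto A t)%N.
Proof.
case: t => // t; rewrite ltnS => st At; rewrite nb_uptoS At addn1 ltnS.
exact: nb_upto_homo.
Qed.

Lemma ltn_nb_upto A s t : (nb_upto A s < nb_upto A t)%N -> (s < t)%N.
Proof. by rewrite !ltnNge; apply: contra; exact: nb_upto_homo. Qed.

(** The counting function advances by one between consecutive elements: this is
    what turns iterated first times into counting statements. *)
Lemma nb_upto_gap (A : pred nat) s t : (s < t)%N -> A t ->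
  (forall u, (s < u < t)%N -> ~~ A u) -> nb_upto A t = (nb_upto A s).+1.
Proof.
case: t => // t st At H; rewrite nb_uptoS At addn1; congr _.+1.
rewrite /nb_upto (big_cat_nat (n := s.+1))//= [X in (_ + X)%N]big1_seq ?addn0//.
by move=> u; rewrite mem_index_iota => /andP[_ /H/negbTE ->].
Qed.

Section records.
Context {R : realType}.
Implicit Types (V : pred nat) (S : nat -> R).

(** With V the visits to i and S the walk, the positive records are the times
    at which the embedded walk has a strict ascending ladder epoch. *)
Definition record V S (t : nat) : bool :=
  V t && [forall u : 'I_t, V u ==> (S u < S t)].

Definition nb_records V S (t : nat)  : nat :=
  nb_upto (record V S) t.

Lemma recordP V S t :
  reflect (V t /\ forall u, (u < t)%N -> V u -> S u < S t) (record V S t).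
Proof.
apply: (iffP andP) => -[Vt H]; split=> //.
  by move=> u ut Vu; move/forallP/(_ (Ordinal ut))/implyP: H; apply.
by apply/forallP => u; apply/implyP => Vu; exact: H.
Qed.

Lemma record_ext V V' S S' t :
  (forall u, (u <= t)%N -> V u = V' u) -> (forall u, (u <= t)%N -> S u = S' u) ->
  record V S t = record V' S' t.
Proof.
move=> eV eS; rewrite /record eV// eS//; congr andb.
by apply: eq_forallb => u; rewrite eV ?eS// ltnW.
Qed.

Lemma nb_records_ext V V' S S' t :
  (forall u, (u <= t)%N -> V u = V' u) -> (forall u, (u <= t)%N -> S u = S' u) ->
  nb_records V S t = nb_records V' S' t.
Proof.
move=> eV eS; apply: eq_big_nat => u /andP[_]; rewrite ltnS => ut.
by congr nat_of_bool; apply: record_ext => v /leq_trans/(_ ut);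
  [exact: eV|exact: eS].
Qed.

End records.

(** * The cycle lemma *)

Lemma big_period (I : Type) (idx : I) (op : Monoid.com_law idx) (n : nat)
    (f : nat -> I) (s : nat) :
  (forall t, f (t + n)%N = f t) ->
  \big[op/idx]_(0 <= t < n) f (s + t)%N = \big[op/idx]_(0 <= t < n) f t.
Proof.
move=> fn; elim: s => // s IH; rewrite -{}IH; case: n fn => [|n] fn.
  by rewrite !big_geq.
rewrite [RHS]big_nat_recl// big_nat_recr//= Monoid.mulmC addSnnS fn addn0.
by congr (op _ _); apply: eq_bigr => t _; rewrite addSnnS.
Qed.

Section cycle_lemma.
Context {R : realType} (n : nat) (V : pred nat) (S : nat -> R) (c : R).
Hypothesis n0 : (0 < n)%N.
Hypothesis Vn : forall t, V (t + n)%N = V t.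
Hypothesis Sn : forall t, S (t + n)%N = S t + c.

(* [Vs s] and [Ss s] are the sequences read from time [s] on, and [G] marks the
   records from time [n] on.  For [c > 0] those are [n]-periodic: a record moved
   forward by a period rises by [c], hence stays above the first period. *)
Let Vs s t := V (s + t)%N.
Let Ss s t := S (s + t)%N.
Let G t := record V S (n + t).
Let r := (\sum_(0 <= t < n) G t)%N.

Let record_shiftP s t :
  reflect (V (s + t)%N /\
    forall u, (s <= u < s + t)%N -> V u -> S u < S (s + t)%N)
  (record (Vs s) (Ss s) t).
Proof.
apply: (iffP (recordP _ _ _)) => -[Vt H]; split=> //.
  move=> u /andP[su ut] Vu; have := H (u - s)%N.
  rewrite /Vs /Ss subnKC//; apply=> //.
  by rewrite ltn_subLR.
by move=> u ut; apply: H; rewrite leq_addr ltn_add2l.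
Qed.

Lemma no_record_nonpos s : c <= 0 -> V s -> record (Vs s) (Ss s) n = false.
Proof.
move=> c0 Vs0; apply/negP => /record_shiftP[_ /(_ s)].
rewrite leqnn -[X in (X < _)%N]addn0 ltn_add2l n0 Vs0 => /(_ isT isT).
by rewrite Sn ltNge; apply/negP; rewrite negbK gerDl.
Qed.

Hypothesis c0 : 0 < c.

Let ltSn t : S t < S (t + n)%N. Proof. by rewrite Sn ltrDl. Qed.

Let G_period t : G (t + n)%N = G t.
Proof.
rewrite /G addnA; apply/recordP/recordP => -[Vt H]; split.
- by rewrite -Vn.
- move=> u ut Vu; have := H (u + n)%N.
  by rewrite ltn_add2r !Sn ltrD2r; apply=> //; rewrite Vn.
- by rewrite Vn.
- move=> u ut Vu; have [nu|un] := leqP n u.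
    rewrite -(subnK nu) !Sn ltrD2r; apply: H; last by rewrite -Vn subnK.
    by rewrite ltn_subLR// addnC.
  apply: (lt_trans _ (ltSn _)); apply: H => //.
  by rewrite (leq_trans un)// leq_addr.
Qed.

(* The times before [s] that are forgotten when starting at [s] cannot spoil a
   record: translated by [n] they are higher and lie in [[s, n + s)]. *)
Let record_shift_full s : (s < n)%N -> V s -> record (Vs s) (Ss s) n = G s.
Proof.
move=> sn Vs0; rewrite /G addnC.
apply/record_shiftP/recordP => -[Vt H]; split=> //.
  move=> u ut Vu; have [su|us] := leqP s u; first by apply: H; rewrite ?su.
  apply: (lt_trans (ltSn _)); apply: H; last by rewrite Vn.
  by rewrite ltn_add2r us andbT (leq_trans (ltnW sn))// leq_addl.
by move=> u /andP[_ ut]; exact: H.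
Qed.

(* Starting at a record forgets only lower values, so the records seen from
   there are those of the whole periodic sequence. *)
Let record_shift_part s t : (0 < t)%N -> V s -> G s ->
  record (Vs s) (Ss s) t = G (s + t)%N.
Proof.
move=> t0 Vs0 /recordP[_ Gs].
apply/record_shiftP/recordP => -[Vt H]; split.
- by rewrite addnC Vn.
- move=> u; rewrite [(n + _)%N]addnC Sn => ut Vu.
  have [nu|un] := leqP (n + s) u.
    have nu' : (n <= u)%N by rewrite (leq_trans _ nu)// leq_addr.
    rewrite -(subnK nu') Sn ltrD2r; apply: H; last by rewrite -Vn subnK.
    by rewrite leq_subRL// nu ltn_subLR// addnC.
  apply: (lt_trans (Gs _ un Vu)); rewrite addnC Sn ltrD2r.
  by apply: H => //; rewrite leqnn -[X in (X < _)%N]addn0 ltn_add2l.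
- by rewrite -Vn addnC.
- move=> u /andP[su ut] Vu; have := H (u + n)%N.
  rewrite [(n + _)%N]addnC ltn_add2r !Sn ltrD2r; apply=> //.
  by rewrite Vn.
Qed.

Let nb_records_shift s : V s -> G s -> nb_records (Vs s) (Ss s) n = r.
Proof.
move=> Vs0 Gs; rewrite /nb_records /nb_upto big_add1/=.
rewrite /r -(@big_period _ _ addn n (fun t => nat_of_bool (G t)) s.+1)/=.
  by apply: eq_bigr => t _; rewrite record_shift_part// addSnnS.
by move=> t; rewrite G_period.
Qed.

(* The first place where [S] is maximal over the visits of the first period
   gives a record one period later. *)
Let r_gt0 : (exists2 s, (s < n)%N & V s) -> (0 < r)%N.
Proof.
case=> s0 s0n Vs0.
have [s [sn Vs1 smax sfst]] : exists s, [/\ (s < n)%N, V s,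
    forall u, (u < n)%N -> V u -> S u <= S s &
    forall u, (u < s)%N -> V u -> S u < S s].
  pose A s := [&& (s < n)%N, V s & [forall u : 'I_n, V u ==> (S u <= S s)]].
  have exA : exists s, A s.
    have [s Vs1 smax] := @arg_maxP _ _ _ (Ordinal s0n) (fun u => V u)
      (fun u : 'I_n => S u) Vs0.
    exists s; rewrite /A ltn_ord Vs1/=; apply/forallP => u; apply/implyP => Vu.
    exact: smax.
  case: (ex_minnP exA) => s /and3P[sn Vs1 /forallP smax] sfst.
  exists s; split=> //.
    by move=> u un Vu; have /implyP := smax (Ordinal un); apply.
  move=> u us Vu; rewrite ltNge; apply/negP => su.
  have : A u.
    rewrite /A (ltn_trans us sn) Vu/=; apply/forallP => v; apply/implyP => Vv.
    by apply: le_trans su; have /implyP := smax v; apply.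
  by move=> /sfst; rewrite leqNgt us.
have Gs : G s.
  apply/recordP; rewrite addnC Vn; split=> // u ut Vu.
  have [nu|un] := leqP n u; last exact: le_lt_trans (smax _ un Vu) (ltSn s).
  rewrite -(subnK nu) !Sn ltrD2r; apply: sfst; last by rewrite -Vn subnK.
  by rewrite ltn_subLR// addnC.
by rewrite /r (bigD1_seq s) ?mem_index_iota ?iota_uniq//= Gs.
Qed.

Lemma sum_record_pos : (exists2 s, (s < n)%N & V s) ->
  \sum_(0 <= s < n | V s && record (Vs s) (Ss s) n)
     (nb_records (Vs s) (Ss s) n)%:R^-1 = 1 :> R.
Proof.
move=> exV.
transitivity (\sum_(0 <= s < n | G s) (r%:R^-1 : R)).
  rewrite big_nat_cond [RHS]big_nat_cond.
  apply: eq_big => s.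
    have [/andP[_ sn]/=|] := boolP (0 <= s < n)%N => //.
    have [Vs0|nV] := boolP (V s); first by rewrite record_shift_full.
    by apply/esym/negbTE/negP => /recordP[]; rewrite addnC Vn (negbTE nV).
  move=> /and3P[/andP[_ sn] Vs0]; rewrite record_shift_full// => Gs.
  by rewrite nb_records_shift.
rewrite big_mkcond/= (eq_bigr (fun s => (nat_of_bool (G s))%:R * r%:R^-1)); last first.
  by move=> s _; case: (G s); rewrite (mul1r, mul0r).
by rewrite -mulr_suml -natr_sum divff// pnatr_eq0 -lt0n r_gt0.
Qed.

End cycle_lemma.

Lemma sum_inv_delta (R : realType) (n m : nat) (b : bool) :
  (m <= n)%N -> (b -> 0 < m)%N ->
  \sum_(1 <= k < n.+1) (k%:R^-1 * (b && (m == k))%:R) = b%:R / m%:R :> R.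
Proof.
move=> mn; case: b => /= [/(_ isT) m0|_]; last first.
  by rewrite mul0r big1// => k _; rewrite mulr0.
rewrite (bigD1_seq m) ?mem_index_iota ?m0 ?ltnS ?iota_uniq//= eqxx mulr1 mul1r.
by rewrite big1 ?addr0// => k km; rewrite eq_sym (negbTE km) mulr0.
Qed.

(** The inner sum over [k] is the reciprocal of the number of records of the
    sequence started at [s], on the event that it ends at a record.  For [c > 0]
    that number does not depend on [s] and equals the number of admissible [s]
    in a period; for [c <= 0] the end never exceeds the start, itself a visit. *)
Lemma cycle_lemma (R : realType) (n : nat) (V : pred nat) (S : nat -> R) (c : R) :
  (0 < n)%N -> (forall t, V (t + n)%N = V t) ->
  (forall t, S (t + n)%N = S t + c) -> (exists2 s, (s < n)%N & V s) ->
  \sum_(0 <= s < n) \sum_(1 <= k < n.+1) k%:R^-1 *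
    [&& V s, record (fun t => V (s + t)%N) (fun t => S (s + t)%N) n
     & nb_records (fun t => V (s + t)%N) (fun t => S (s + t)%N) n == k]%:R
  = (0 < c)%R%:R :> R.
Proof.
move=> n0 Vn Sn exV.
under eq_bigr => s _ do (under eq_bigr do rewrite andbA;
  rewrite (sum_inv_delta _ (nb_upto_le _ _));
  last by (case/andP => ? ?; exact: nb_upto_gt0)).
have [c0|c0] := ltP 0 c.
  rewrite -[RHS](sum_record_pos Vn Sn c0 exV) [RHS]big_mkcond/=.
  by apply: eq_bigr => s _; case: ifP; rewrite ?mul1r ?mul0r.
rewrite big1// => s _; case: (boolP (V s)) => [Vs|]; last by rewrite mul0r.
by rewrite (no_record_nonpos n0 Sn)// mul0r.
Qed.

(** * Return epochs and ladder epochs as counting times *)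

Lemma first_timeP (A : pred nat) t :
  first_time A = Some t <-> A t /\ forall u, (u < t)%N -> ~~ A u.
Proof.
rewrite /first_time; case: pselect => [e|nA]; last first.
  by split=> // -[At _]; case: nA; exists t.
case: (ex_minnP e) => s As smin; split=> [[<-]|[At tmin]].
  by split=> // u us; apply/negP => /smin; rewrite leqNgt us.
congr Some; apply/eqP; rewrite eqn_leq smin//= leqNgt.
by apply/negP => /tmin; rewrite As.
Qed.

Lemma first_time_gtP (A : pred nat) s t :
  first_time [pred m | (s < m)%N && A m] = Some t <->
  [/\ (s < t)%N, A t & forall u, (s < u < t)%N -> ~~ A u].
Proof.
rewrite first_timeP; split=> [[/andP[st At] H]|[st At H]].
  by split=> // u /andP[su ut]; have := H u ut; rewrite /= su.
by split=> [|u ut]; [exact/andP|rewrite /= negb_and -implybE; apply/implyP => su];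
  apply: H; rewrite su.
Qed.

(** Induction step shared by return and ladder epochs: the next element of [A]
    after its k-th one is its (k+1)-st one.  Time 0 is the zeroth element,
    whether or not [A] holds there. *)
Lemma nb_upto_next (A : pred nat) k t :
  (exists s, [/\ (s == 0%N) || A s, nb_upto A s = k &
     [/\ (s < t)%N, A t & forall u, (s < u < t)%N -> ~~ A u]]) <->
  [/\ (0 < t)%N, A t & nb_upto A t = k.+1].
Proof.
split=> [[s [Bs ns [st At H]]]|[t0 At nt]].
  split=> //; first exact: leq_ltn_trans st.
  by rewrite (nb_upto_gap st) ?ns.
have exB : exists s, (s < t)%N && ((s == 0%N) || A s) by exists 0%N; rewrite t0.
have bB s : (s < t)%N && ((s == 0%N) || A s) -> (s <= t)%N by case/andP => /ltnW.
case: (ex_maxnP exB bB) => s /andP[st Bs] smax; exists s.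
have H u : (s < u < t)%N -> ~~ A u.
  case/andP => su ut; apply/negP => Au; have := smax u.
  by rewrite ut Au orbT => /(_ isT); rewrite leqNgt su.
by split=> //; move: nt; rewrite (nb_upto_gap st)// => -[].
Qed.

Section epochs.
Context {R : realType} {S : countType} {d : measure_display}
  {T : measurableType d} (M : nat -> T -> S) (X : nat -> T -> R) (i : S) (w : T).

Definition visit (t : nat) : bool := M t w == i.

(* Time 0 counts as a visit, whatever the initial state. *)
Definition visit0 (t : nat) : bool := (t == 0%N) || visit t.

Let W t := walk X t w.

Lemma return_epochP m t :
  return_epoch M i m w = Some t <-> visit0 t /\ nb_upto visit t = m.
Proof.
elim: m t => [|m IH] t /=.
  split=> [[<-]|[V0 nt]]; first by rewrite nb_upto0.
  congr Some; case: t => // t in V0 nt *.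
  by move: nt; rewrite nb_uptoS; move: V0; rewrite /visit0/= => ->; rewrite addn1.
transitivity [/\ (0 < t)%N, visit t & nb_upto visit t = m.+1]; last first.
  split=> [[t0 Vt nt]|[]]; first by rewrite /visit0 Vt orbT.
  by case: t => [|t] Vt nt; [rewrite nb_upto0 in nt|].
rewrite -nb_upto_next; split.
  case E: return_epoch => [s|]//= /first_time_gtP H; exists s.
  by have /IH[] := E.
by case=> s [Bs ns H]; have /IH -> /= := conj Bs ns; apply/first_time_gtP.
Qed.

(** From a record, the first visit that exceeds it is the next record: a visit
    in between that exceeds it could be taken minimal and would be a record. *)
Lemma record_next s t : record visit0 W s ->
  [/\ (s < t)%N, visit t && (W s < W t) &
      forall u, (s < u < t)%N -> ~~ (visit u && (W s < W u))] <->
  [/\ (s < t)%N, record visit0 W t &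
      forall u, (s < u < t)%N -> ~~ record visit0 W u].
Proof.
move=> /recordP[Vs sW].
have above u : (s < u)%N -> record visit0 W u -> visit u && (W s < W u).
  move=> su /recordP[Vu uW]; rewrite uW// andbT.
  by move: Vu; rewrite /visit0 gtn_eqF// (leq_ltn_trans _ su).
have low t' : (s < t')%N -> (forall u, (s < u < t')%N -> ~~ (visit u && (W s < W u))) ->
    forall u, (u < t')%N -> visit0 u -> W u <= W s.
  move=> st H u ut Vu; have [us|su|-> //] := ltngtP u s; first exact/ltW/sW.
  have := H u; rewrite su ut => /(_ isT).
  move: Vu; rewrite /visit0 gtn_eqF ?(leq_ltn_trans _ su)//= => ->/=.
  by rewrite ltNge negbK.
have rec t' : (s < t')%N -> visit t' && (W s < W t') ->
    (forall u, (s < u < t')%N -> ~~ (visit u && (W s < W u))) ->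
    record visit0 W t'.
  move=> st /andP[Vt Wt] H; apply/recordP; rewrite /visit0 Vt orbT; split=> //.
  by move=> u ut Vu; apply: le_lt_trans Wt; exact: (low _ st H).
split=> -[st At H].
  split=> //; first exact: rec.
  move=> u /[dup] sut /andP[su ut]; apply: contra (H u sut); exact: above.
split=> //; first exact: above.
move=> u /andP[su ut]; apply/negP => Au.
have exA : exists u, (s < u < t)%N && (visit u && (W s < W u)).
  by exists u; rewrite su ut.
case: (ex_minnP exA) => v /andP[/andP[sv vt] Av] vmin.
have := H v; rewrite sv vt => /(_ isT)/negP; apply; apply: rec => //.
move=> z /andP[sz zv]; apply/negP => Az; have := vmin z.
by rewrite sz (ltn_trans zv vt) => /(_ Az); rewrite leqNgt zv.
Qed.

(** Ladder epochs are indexed by return epochs, but since the return epochs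
    increase with their index, the recursion can be carried out on the times
    themselves, where [record_next] applies. *)
Lemma return_epoch_at_ladderP k t :
  return_epoch_at_ladder M X i k w = Some t <->
  record visit0 W t /\ nb_records visit0 W t = k.
Proof.
have rec0 : record visit0 W 0 by apply/recordP.
rewrite /return_epoch_at_ladder.
elim: k t => [|k IH] t.
  split=> [[<-]|[Vt nt]]; first by rewrite /nb_records nb_upto0.
  congr Some; case: t => // t in Vt nt *.
  by move: nt; rewrite /nb_records nb_uptoS Vt addn1.
transitivity [/\ (0 < t)%N, record visit0 W t & nb_records visit0 W t = k.+1];
  last first.
  by split=> [[]|[]]//; case: t => // ? nt; rewrite /nb_records nb_upto0 in nt.
rewrite -nb_upto_next.
transitivity (exists s, obind (fun m => return_epoch M i m w)
                          (ladder_epoch M X i k w) = Some s /\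
    [/\ (s < t)%N, visit t && (W s < W t) &
      forall u, (s < u < t)%N -> ~~ (visit u && (W s < W u))]); last first.
  split=> -[s].
    move=> [/IH[rs ns] /(record_next _ rs)H]; exists s; split=> //.
    by rewrite rs orbT.
  move=> [Bs ns H]; have rs : record visit0 W s by case/orP: Bs => // /eqP ->.
  by exists s; split; [exact/IH|exact/(record_next _ rs)].
rewrite /=; case: (ladder_epoch M X i k w) => [m|]/=; last by split=> // -[s []].
split.
  case E: first_time => [m'|]//= E'; move/first_time_gtP: E => [mm' lt_mm' H].
  move: lt_mm' H; rewrite /embedded_walk_lt E'; case Em: return_epoch => [s|]// Wst H.
  exists s; split=> //.
  have [Vs ns] := (return_epochP _ _).1 Em.
  have [Vt nt] := (return_epochP _ _).1 E'.
  have st : (s < t)%N by apply: (@ltn_nb_upto visit); rewrite ns nt.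
  have Vt' : visit t by move: Vt; rewrite /visit0 gtn_eqF// (leq_ltn_trans _ st).
  split=> //; first by rewrite Vt'.
  move=> u /andP[su ut]; apply/negP => /andP[Vu Wu].
  have /return_epochP Eu : visit0 u /\ nb_upto visit u = nb_upto visit u.
    by rewrite /visit0 Vu orbT.
  have := H (nb_upto visit u); rewrite Eu => /(_ _)/negP; apply=> //.
  rewrite -ns -nt.
  by rewrite !nb_upto_ltn.
case=> s [Em [st /andP[Vt Wst] H]].
have [Vs ns] := (return_epochP _ _).1 Em.
have /return_epochP Et : visit0 t /\ nb_upto visit t = nb_upto visit t.
  by rewrite /visit0 Vt orbT.
suff /first_time_gtP -> : [/\ (m < nb_upto visit t)%N,
    embedded_walk_lt M X i m (nb_upto visit t) w &
    forall u, (m < u < nb_upto visit t)%N -> ~~ embedded_walk_lt M X i m u w].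
  by [].
split; first by rewrite -ns nb_upto_ltn.
  by rewrite /embedded_walk_lt Em Et.
move=> u /andP[mu ut]; rewrite /embedded_walk_lt Em.
case Eu: return_epoch => [v|]//; have [Vv nv] := (return_epochP _ _).1 Eu.
have sv : (s < v)%N by apply: (@ltn_nb_upto visit); rewrite ns nv.
have vt : (v < t)%N by apply: (@ltn_nb_upto visit); rewrite nv.
have Vv' : visit v by move: Vv; rewrite /visit0 gtn_eqF// (leq_ltn_trans _ sv).
by have := H v; rewrite sv vt Vv' => /(_ isT).
Qed.

Lemma ladder_epochE k t : return_epoch_at_ladder M X i k w = Some t ->
  ladder_epoch M X i k w = Some (nb_upto visit t).
Proof.
by rewrite /return_epoch_at_ladder; case: ladder_epoch => //= m /return_epochP[_ ->].
Qed.

End epochs.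

(** * Cyclic invariance of the bridge *)

(** The enumeration of [C] by [pickle] turns the fibers into a sequence of
    disjoint sets, empty at the integers that encode nothing. *)
Lemma measure_fibers (d : measure_display) (T : measurableType d) (R : realType)
    (mu : {measure set T -> \bar R}) (C : countType) (f : T -> C) (E : set T) :
  (forall c, measurable (E `&` f @^-1` [set c])) ->
  mu E = \esum_(c in [set: C]) mu (E `&` f @^-1` [set c]).
Proof.
move=> mE; pose F k := E `&` [set w | pickle (f w) = k].
have Fp c : F (pickle c) = E `&` f @^-1` [set c].
  apply/seteqP; split=> w [Ew] /=; last by move=> <-.
  by move=> /(pcan_inj pickleK) fw; split.
have F0 k : ~ range (@pickle C) k -> F k = set0.
  move=> nk; apply/seteqP; split=> // w [_ /= fw]; apply: nk.
  by exists (f w).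
have mF k : measurable (F k).
  by have [[c _ <-]|/F0 ->] := pselect (range (@pickle C) k);
    [rewrite Fp|exact: measurable0].
have EF : E = \bigcup_k F k.
  by apply/seteqP; split=> [w Ew|w [k _ []]//]; exists (pickle (f w)).
rewrite {1}EF measure_bigcup//; last first.
  by move=> j k _ _ [w [[_ /= <-] [_ /= <-]]].
rewrite nneseries_esum// (_ : [set x | _] = [set: nat]); last first.
  by apply/seteqP; split=> // k _ /=; rewrite inE.
transitivity (\esum_(k in range (@pickle C)) mu (F k)).
  rewrite [RHS]esum_mkcond; apply: eq_esum => k _.
  by case: ifPn => //; rewrite notin_setE => /F0 ->; rewrite measure0.
rewrite (@reindex_esum R C nat setT (range (@pickle C)) (@pickle C)).
  by apply: eq_esum => c _; rewrite Fp.
by split=> [c _|c c' _ _ /(pcan_inj pickleK)|k [c _ <-]]//; exists c.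
Qed.

Section rectangles.
Context {R : realType}.

(** Only the first [n] coordinates are observed: the rectangles generate the
    sigma-algebra of the first [n] terms of a sequence. *)
Definition rectangles (n : nat) : set (set (nat -> measurableTypeR R)) :=
  [set A | exists2 B : nat -> set (measurableTypeR R),
    (forall l, measurable (B l)) &
    A = [set y | forall l, (l < n)%N -> B l (y l)]].

Definition sequences_upto (n : nat) := g_sigma_algebraType (rectangles n).

HB.instance Definition _ n := Measurable.on (sequences_upto n).

Lemma rectanglesI n : setI_closed (rectangles n).
Proof.
move=> _ _ [B mB ->] [C mC ->]; exists (fun l => B l `&` C l).
  by move=> l; exact: measurableI.
apply/seteqP; split=> y /=; first by move=> [By Cy] l ln; split; auto.
by move=> H; split=> l /H[].
Qed.

Lemma rectanglesT n : rectangles n setT.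
Proof. by exists (fun=> setT) => //; apply/seteqP; split. Qed.

Lemma measurable_coordinate n l : (l < n)%N ->
  measurable_fun [set: sequences_upto n] (fun y => y l).
Proof.
move=> ln _ B mB; rewrite setTI; apply: sub_sigma_algebra.
exists (fun j => if j == l then B else setT).
  by move=> j; case: ifP => // _; exact: measurableT.
apply/seteqP; split=> y /=; first by move=> By j _; case: eqP => // ->.
by move=> /(_ l ln); rewrite eqxx.
Qed.

Lemma measurable_sequences (d : measure_display) (T : measurableType d) n
    (f : T -> nat -> measurableTypeR R) :
  (forall l, (l < n)%N -> measurable_fun setT (fun w => f w l)) ->
  measurable_fun [set: T] (f : T -> sequences_upto n).
Proof.
move=> mf.
apply: (@measurability _ _ T (sequences_upto n) setT f (rectangles n) erefl).
move=> _ [_ [B mB ->] <-]; rewrite setTI.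
rewrite (_ : _ @^-1` _ = \bigcap_(l in `I_n) (fun w => f w l) @^-1` B l)//.
apply: fin_bigcap_measurable => // l ln.
by rewrite -[X in measurable X]setTI; exact: mf.
Qed.

End rectangles.

Section bridge.
Context {R : realType} {S : countType} {d : measure_display}
  {T : measurableType d} (P : probability T R) (p : S -> S -> R)
  (K : S -> S -> probability (measurableTypeR R) R)
  (M : nat -> T -> S) (X : nat -> T -> R) (i : S).
Hypothesis start : P [set w | M 0%N w = i] = 1%E.
Hypothesis chain : markov_chain P p M.
Hypothesis increments : conditional_increments P K M X.

Lemma measurable_path_event m x : measurable (path_event M m x).
Proof.
rewrite (_ : path_event M m x = \bigcap_(k in `I_m.+1) [set w | M k w = x k])//.
by apply: fin_bigcap_measurable => // k _; exact: chain.1.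
Qed.

Lemma cond_probE (A B : set T) (c : \bar R) : measurable B -> P B != 0%E ->
  cond_prob P A B = c -> P (A `&` B) = (c * P B)%E.
Proof.
move=> mB PB <-; rewrite /cond_prob -muleA mulVe ?mule1//.
exact: fin_num_measure.
Qed.

(** When the path up to time [m] has probability zero, the conditional
    probability says nothing, but both sides vanish. *)
Lemma probability_path m x : x 0%N = i ->
  P (path_event M m x) = (\prod_(0 <= l < m) (p (x l) (x l.+1))%:E)%E.
Proof.
move=> x0; elim: m => [|m IH].
  rewrite big_geq// -start; congr (P _); apply/seteqP; split=> w /=.
    by move=> /(_ 0%N (leqnn _)) ->.
  by move=> M0 k; rewrite leqn0 => /eqP ->; rewrite x0.
have -> : path_event M m.+1 x = [set w | M m.+1 w = x m.+1] `&` path_event M m x.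
  apply/seteqP; split=> w /=.
    by move=> H; split=> [|k km]; apply: H => //; exact: leqW.
  by move=> [Mm H] k; rewrite leq_eqVlt => /predU1P[->//|]; exact: H.
rewrite big_nat_recr//= -IH; have [P0|P0] := eqVneq (P (path_event M m x)) 0%E.
  rewrite P0 mul0e; apply/eqP; rewrite eq_le measure_ge0 andbT -P0.
  by apply: measureIr; [exact: chain.1|exact: measurable_path_event].
by rewrite (cond_probE (measurable_path_event _ _) P0 (chain.2 _ _ P0)) muleC.
Qed.

Lemma probability_path_rectangle m x (B : nat -> set (measurableTypeR R)) :
  x 0%N = i -> (forall l, measurable (B l)) ->
  P ([set w | forall l, (l < m)%N -> B l (X l.+1 w)] `&` path_event M m x) =
  (\prod_(0 <= l < m) ((p (x l) (x l.+1))%:E * K (x l) (x l.+1) (B l)))%E.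
Proof.
move=> x0 mB; case: m => [|m].
  rewrite big_geq// (_ : [set w | _] = setT) ?setTI ?probability_path ?big_geq//.
  by apply/seteqP; split.
rewrite big_split/= -probability_path//.
have [P0|P0] := eqVneq (P (path_event M m.+1 x)) 0%E.
  rewrite P0 mul0e; apply/eqP; rewrite eq_le measure_ge0 andbT -P0.
  apply: measureIr; last exact: measurable_path_event.
  rewrite (_ : mkset _ = \bigcap_(l in `I_m.+1) (X l.+1) @^-1` B l)//.
  apply: fin_bigcap_measurable => // l _; rewrite -[X in measurable X]setTI.
  exact: (increments.1 l.+1 measurableT _ (mB l)).
have := @cond_probE _ _ _ (measurable_path_event _ _) P0
  (increments.2 m.+1 x (fun l => B l.-1) isT (fun l => mB l.-1) P0).
rewrite big_add1/= muleC => <-; congr (P (_ `&` _)).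
apply/seteqP; split=> w /= H l; first by case: l => // l /H.
by move=> lm; have := H l.+1; apply.
Qed.

Variable n : nat.
Hypothesis n0 : (0 < n)%N.

Lemma measurable_increments s :
  measurable_fun setT ((fun w l => X ((l + s) %% n).+1 w) : T -> sequences_upto n).
Proof. by apply: measurable_sequences => l _; exact: increments.1. Qed.

Lemma measurable_increments0 :
  measurable_fun setT ((fun w l => X (l %% n).+1 w) : T -> sequences_upto n).
Proof. by apply: measurable_sequences => l _; exact: increments.1. Qed.

(** On rectangles both sides are products over the edges of the same cycle,
    merely started at different edges; the hypothesis [x s = i] is needed because
    the law [P] governs only paths that start in [i]. *)
Lemma probability_path_shift x s : (forall l, x (l + n)%N = x l) ->
  x 0%N = i -> x s = i ->
  forall A : set (sequences_upto n), measurable A ->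
  P ((fun w l => X (l %% n).+1 w) @^-1` A `&` path_event M n (fun l => x (l + s)%N)) =
  P ((fun w l => X ((l + s) %% n).+1 w) @^-1` A `&` path_event M n x).
Proof.
move=> xn x0 xs.
pose mu1 : {measure set (sequences_upto n) -> \bar R} :=
  measure_function_pushforward__canonical__measure_function_Measure
   (mrestr P (measurable_path_event n (fun l => x (l + s)%N))) measurable_increments0.
pose mu2 : {measure set (sequences_upto n) -> \bar R} :=
  measure_function_pushforward__canonical__measure_function_Measure
   (mrestr P (measurable_path_event n x)) (measurable_increments s).
suff mu12 A : rectangles n A -> mu1 A = mu2 A.
  move=> A mA; have := @measure_unique _ _ (sequences_upto n) (rectangles n)
    (fun=> setT) erefl (@rectanglesI _ n) (fun=> rectanglesT n) _ mu1 mu2 mu12 _ A mA.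
  apply; first by rewrite bigcup_const//; exists 0%N.
  move=> _; apply: (le_lt_trans _ (ltry 1)); apply: probability_le1.
  by apply: measurableI; [exact: measurableT|exact: measurable_path_event].
case=> B mB ->.
(* [s * n.-1] is [- s] modulo [n]. *)
pose C l := B ((l + s * n.-1) %% n)%N.
pose f l := ((p (x l) (x l.+1))%:E * K (x l) (x l.+1) (C l))%E.
have CD l : C (l + s)%N = B (l %% n)%N.
  by rewrite /C -addnA -mulnS prednK// addnC modnMDl.
have Cmod l : C (l %% n)%N = C l by rewrite /C modnDml.
transitivity (\prod_(0 <= l < n) f (s + l)%N)%E.
  transitivity (P ([set w | forall l, (l < n)%N -> B l (X l.+1 w)] `&`
      path_event M n (fun l => x (l + s)%N))).
    congr (P (_ `&` _)); apply/seteqP; split=> w /= H l ln; have := H l ln;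
    by rewrite modn_small.
  rewrite probability_path_rectangle//; apply: eq_big_nat => l /andP[_ ln].
  by rewrite /f [(s + l)%N]addnC CD modn_small// addSn.
rewrite (@big_period _ _ mule); last first.
  by move=> l; rewrite /f -addSn !xn -(Cmod (l + n)%N) modnDr Cmod.
rewrite -probability_path_rectangle//; last by move=> l; exact: mB.
congr (P (_ `&` _)); apply/seteqP; split=> w /= H l ln.
  by have := H ((l + s) %% n)%N; rewrite Cmod CD (modn_small ln) ltn_mod; apply.
have := H ((l + s * n.-1) %% n)%N; rewrite ltn_mod => /(_ n0).
suff -> : (((l + s * n.-1) %% n + s) %% n)%N = l by [].
by rewrite modnDml -addnA -mulnSr prednK// addnC modnMDl modn_small.
Qed.

(** A bridge of length [n] has its end fixed by its start, so it is encoded by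
    its first [n] states and read back as an [n]-periodic sequence. *)
Definition periodize (x : {ffun 'I_n -> S}) (l : nat) : S :=
  x (Ordinal (ltn_pmod l n0)).

Definition rotate_path (s : nat) (x : {ffun 'I_n -> S}) : {ffun 'I_n -> S} :=
  [ffun l : 'I_n => periodize x (l + s)].

Lemma periodize_mod x l l' : l = l' %[mod n] -> periodize x l = periodize x l'.
Proof. by move=> ll'; congr (x _); apply: val_inj. Qed.

Lemma periodize_rotate s x l :
  periodize (rotate_path s x) l = periodize x (l + s).
Proof. by rewrite /periodize ffunE; apply: periodize_mod; rewrite /= modnDml. Qed.

Lemma rotate_path_bij s : (s <= n)%N ->
  set_bij [set: {ffun 'I_n -> S}] [set: {ffun 'I_n -> S}] (rotate_path s).
Proof.
move=> sn; rewrite setTT_bijective; exists (rotate_path (n - s)) => x;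
  apply/ffunP => l; rewrite ffunE periodize_rotate /periodize -addnA;
  congr (x _); apply: val_inj => /=.
  by rewrite subnK// modnDr modn_small.
by rewrite subnKC// modnDr modn_small.
Qed.

(** Sum over the bridges: on the right, rename each bridge as the rotation by
    [s] of another one.  Its start is then the state at time [s] of the original,
    and its state at time [n - s] is the original start. *)
Lemma bridge_shift s (Q : (nat -> S) -> set (sequences_upto n)) :
  (forall x, measurable (Q x)) -> (s <= n)%N ->
  P [set w | [/\ M 0%N w = i, M n w = i, M s w = i &
    Q (fun l => M ((l + s) %% n)%N w) (fun l => X ((l + s) %% n).+1 w)]] =
  P [set w | [/\ M 0%N w = i, M n w = i, M (n - s)%N w = i &
    Q (fun l => M (l %% n)%N w) (fun l => X (l %% n).+1 w)]].
Proof.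
move=> mQ sn; set E1 := [set w | _]; set E2 := [set w | _].
pose f w : {ffun 'I_n -> S} := [ffun l : 'I_n => M l w].
have fM w x : f w = x -> forall l, (l < n)%N -> M l w = periodize x l.
  move=> <- l ln; rewrite /periodize ffunE /=; congr (M _ w).
  by rewrite modn_small.
have Mf w x : path_event M n (periodize x) w -> f w = x.
  move=> Mx; apply/ffunP => l; rewrite ffunE Mx; last exact/ltnW.
  by congr (x _); apply: val_inj; rewrite /= modn_small.
have per0 x : periodize x n = periodize x 0.
  by apply: periodize_mod; rewrite modnn mod0n.
have path w x : f w = x -> M 0%N w = i -> M n w = i -> path_event M n (periodize x) w.
  move=> fw M0 Mn l; rewrite leq_eqVlt => /predU1P[->|]; last exact: fM.
  by rewrite Mn per0 -(fM _ _ fw).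
have fib1 x : E1 `&` f @^-1` [set x] =
    if (periodize x 0 == i) && (periodize x s == i) then
      (fun w l => X ((l + s) %% n).+1 w) @^-1` Q (fun l => periodize x (l + s)) `&`
      path_event M n (periodize x)
    else set0.
  have MQ w : path_event M n (periodize x) w ->
      (fun l => M ((l + s) %% n)%N w) = (fun l => periodize x (l + s)).
    move=> Mx; apply/funext => l; rewrite Mx; last by rewrite ltnW// ltn_mod.
    by apply: periodize_mod; rewrite modn_mod.
  apply/seteqP; split=> w /=.
    move=> [[M0 Mn Ms Qw] fw]; have Mx := path _ _ fw M0 Mn.
    rewrite -(Mx 0%N)// -(Mx s)// M0 Ms eqxx/=; split=> //.
    by rewrite -(MQ _ Mx).
  case: ifPn => // /andP[/eqP x0 /eqP xs] [Qw Mx].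
  split; last exact: Mf.
  by split; rewrite ?Mx ?per0// MQ.
have fib2 x : E2 `&` f @^-1` [set x] =
    if (periodize x 0 == i) && (periodize x (n - s) == i) then
      (fun w l => X (l %% n).+1 w) @^-1` Q (periodize x) `&`
      path_event M n (periodize x)
    else set0.
  have MQ w : path_event M n (periodize x) w ->
      (fun l => M (l %% n)%N w) = periodize x.
    move=> Mx; apply/funext => l; rewrite Mx; last by rewrite ltnW// ltn_mod.
    by apply: periodize_mod; rewrite modn_mod.
  apply/seteqP; split=> w /=.
    move=> [[M0 Mn Ms Qw] fw]; have Mx := path _ _ fw M0 Mn.
    rewrite -(Mx 0%N)// -(Mx (n - s)%N) ?leq_subr// M0 Ms eqxx/=; split=> //.
    by rewrite -(MQ _ Mx).
  case: ifPn => // /andP[/eqP x0 /eqP xs] [Qw Mx].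
  split; last exact: Mf.
  by split; rewrite ?Mx ?per0 ?leq_subr// MQ.
rewrite (measure_fibers P (f := f) (E := E1)); last first.
  move=> x; rewrite fib1; case: ifP => // _; apply: measurableI.
    by rewrite -[X in measurable X]setTI; apply: measurable_increments.
  exact: measurable_path_event.
rewrite (measure_fibers P (f := f) (E := E2)); last first.
  move=> x; rewrite fib2; case: ifP => // _; apply: measurableI.
    by rewrite -[X in measurable X]setTI; apply: measurable_increments0.
  exact: measurable_path_event.
rewrite [RHS](reindex_esum _ _ _ _ (rotate_path_bij sn)); apply: eq_esum => x _.
rewrite fib1 fib2 !periodize_rotate add0n subnK// per0 andbC.
case: ifPn => // /andP[/eqP xs /eqP x0].
have -> : periodize (rotate_path s x) = fun l => periodize x (l + s).
  by apply/funext => l; exact: periodize_rotate.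
apply/esym/probability_path_shift => //.
by move=> l; apply: periodize_mod; rewrite modnDr.
Qed.

End bridge.

(** * The ladder formula *)

Lemma integral_sum_indic (d : measure_display) (T : measurableType d)
    (R : realType) (mu : {measure set T -> \bar R}) (I : Type) (r : seq I)
    (a : I -> R) (E : I -> set T) :
  (forall j, 0 <= a j) -> (forall j, measurable (E j)) ->
  (\int[mu]_w (\sum_(j <- r) a j * \1_(E j) w)%:E =
   \sum_(j <- r) (a j)%:E * mu (E j))%E.
Proof.
move=> a0 mE; under eq_integral do rewrite -sumEFin.
have mind j : measurable_fun setT (fun w => (\1_(E j) w : R)%:E).
  by apply/measurable_EFinP; exact: measurable_indic.
rewrite ge0_integral_sum//.
- apply: eq_bigr => j _; under eq_integral do rewrite EFinM.
  by rewrite ge0_integralZl_EFin// integral_indic// setIT.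
- by move=> j; under eq_fun do rewrite EFinM; exact: measurable_funeM.
- by move=> j w _; rewrite lee_fin mulr_ge0.
Qed.

Section measurable_records.
Context {d : measure_display} {T : measurableType d} {R : realType}
  (V : T -> pred nat) (S : T -> nat -> R).

Lemma measurable_record t :
  (forall u, (u <= t)%N -> measurable_fun setT (V^~ u)) ->
  (forall u, (u <= t)%N -> measurable_fun setT (S^~ u)) ->
  measurable_fun setT (fun w => record (V w) (S w) t).
Proof.
move=> mV mS; apply: measurable_and; first exact: mV.
under eq_fun do rewrite -big_andE big_mkcond.
have mU (u : 'I_t) : measurable_fun setT (fun w => V w u ==> (S w u < S w t)).
  under eq_fun do rewrite implybE.
  apply: measurable_or; first by apply: measurable_neg; apply/mV/ltnW.
  by apply: measurable_fun_ltr; apply: mS => //; exact: ltnW.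
elim: (index_enum _) => [|u r IH].
  by under eq_fun do rewrite big_nil; exact: measurable_cst.
under eq_fun do rewrite big_cons /=.
by apply: measurable_and IH; exact: mU.
Qed.

Lemma measurable_nb_records t :
  (forall u, (u <= t)%N -> measurable_fun setT (V^~ u)) ->
  (forall u, (u <= t)%N -> measurable_fun setT (S^~ u)) ->
  measurable_fun setT (fun w => nb_records (V w) (S w) t).
Proof.
elim: t => [|t IH] mV mS.
  by under eq_fun do rewrite /nb_records nb_upto0; exact: measurable_cst.
under eq_fun do rewrite /nb_records nb_uptoS.
apply: measurable_fun_addn.
  by apply: IH => u ut; [apply: mV|apply: mS]; exact: leqW.
apply: (@measurableT_comp _ _ _ _ _ _ nat_of_bool) => //.
exact: measurable_record.
Qed.

Lemma measurable_record_count t k :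
  (forall u, (u <= t)%N -> measurable_fun setT (V^~ u)) ->
  (forall u, (u <= t)%N -> measurable_fun setT (S^~ u)) ->
  measurable [set w | record (V w) (S w) t /\ nb_records (V w) (S w) t = k].
Proof.
move=> mV mS; apply: measurableI.
  rewrite -[X in measurable X]setTI.
  exact: (@measurable_record t mV mS measurableT [set true]).
rewrite -[X in measurable X]setTI.
exact: (@measurable_nb_records t mV mS measurableT [set k]).
Qed.

End measurable_records.

Lemma record_addr (R : realType) (V : pred nat) (S : nat -> R) (c : R) t :
  record V (fun u => S u + c) t = record V S t.
Proof.
by rewrite /record; congr andb; apply: eq_forallb => u; rewrite ltrD2r.
Qed.

Lemma nb_records_addr (R : realType) (V : pred nat) (S : nat -> R) (c : R) t :
  nb_records V (fun u => S u + c) t = nb_records V S t.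
Proof. by apply: eq_bigr => u _; rewrite record_addr. Qed.

Section ladder_formula.
Context {R : realType} {S : countType} {d : measure_display}
  {T : measurableType d} (P : probability T R) (p : S -> S -> R)
  (K : S -> S -> probability (measurableTypeR R) R)
  (M : nat -> T -> S) (X : nat -> T -> R) (i : S).
Hypothesis start : P [set w | M 0%N w = i] = 1%E.
Hypothesis chain : markov_chain P p M.
Hypothesis increments : conditional_increments P K M X.
Variable n : nat.
Hypothesis n0 : (0 < n)%N.

Definition partial_sum (y : nat -> R) (t : nat) : R := \sum_(0 <= l < t) y l.

Definition ladder_set (k : nat) (x : nat -> S) : set (sequences_upto n) :=
  [set y | record (fun t => x t == i) (partial_sum y) n /\
           nb_records (fun t => x t == i) (partial_sum y) n = k].

Lemma measurable_state t j : measurable [set w | M t w = j].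
Proof. exact: chain.1. Qed.

Lemma measurable_stateb t : measurable_fun setT (fun w => M t w == i).
Proof.
apply: (measurable_fun_bool true); rewrite setTI.
rewrite (_ : _ @^-1` _ = [set w | M t w = i]); first exact: measurable_state.
by apply/seteqP; split=> w /= /eqP.
Qed.

Lemma measurable_partial_sum (d' : measure_display) (T' : measurableType d')
    (y : T' -> nat -> R) t :
  (forall l, (l < t)%N -> measurable_fun setT (y^~ l)) ->
  measurable_fun setT (fun w => partial_sum (y w) t).
Proof.
elim: t => [|t IH] my.
  by under eq_fun do rewrite /partial_sum big_geq//; exact: measurable_cst.
under eq_fun do rewrite /partial_sum big_nat_recr//=.
by apply: measurable_funD; [apply: IH => l lt; apply/my/leqW|exact: my].
Qed.

Lemma measurable_ladder_set k x : measurable (ladder_set k x).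
Proof.
apply: measurable_record_count => u un; first exact: measurable_cst.
apply: measurable_partial_sum => l lu; apply: measurable_coordinate.
exact: leq_trans un.
Qed.

(** The initial state is [i] only almost surely; this puts the exact equality
    into an event. *)
Lemma probability_start (A : set T) : measurable A ->
  P (A `&` [set w | M 0%N w = i]) = P A.
Proof.
move=> mA; have mM0 := measurable_state 0 i.
have P0 : P (~` [set w | M 0%N w = i]) = 0%E.
  by rewrite probability_setC// start subee.
rewrite -[in RHS](setIT A) -(setUv [set w | M 0%N w = i]) setIUr.
have mC := measurableC mM0.
rewrite measureU ?[X in (_ + X)%E](_ : _ = 0%E) ?adde0//.
- apply/eqP; rewrite eq_le measure_ge0 andbT -P0; exact: measureIr.
- exact: measurableI.
- exact: measurableI.
- by rewrite setIACA setICr setI0.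
Qed.

Lemma partial_sum_shift y s t : partial_sum y (s + t) =
  partial_sum y s + partial_sum (fun l => y (l + s)%N) t.
Proof.
rewrite /partial_sum (big_cat_nat (n := s))//= ?leq_addr//; congr (_ + _).
by rewrite -{1}[s]add0n big_addn addKn.
Qed.

Lemma walk_partial_sum w t :
  walk X t w = partial_sum (fun l => X l.+1 w) t.
Proof. by rewrite /walk big_add1. Qed.

Lemma measurable_walk t : measurable_fun setT (walk X t).
Proof.
rewrite (_ : walk X t = fun w => partial_sum (fun l => X l.+1 w) t).
  by apply: measurable_partial_sum => l _; exact: increments.1.
by apply/funext => w; exact: walk_partial_sum.
Qed.

(** The bridge from [i] to [i], read cyclically from its visit [s] on, ends at
    its [k]-th record. *)
Definition ladder_bridge (s k : nat) : set T :=
  [set w | [/\ M 0%N w = i, M n w = i, M s w = i &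
    ladder_set k (fun l => M ((l + s) %% n)%N w)
                 (fun l => X ((l + s) %% n).+1 w)]].

Lemma measurable_ladder_bridge s k : measurable (ladder_bridge s k).
Proof.
rewrite (_ : ladder_bridge s k = [set w | M 0%N w = i] `&` ([set w | M n w = i] `&`
   ([set w | M s w = i] `&` [set w | ladder_set k (fun l => M ((l + s) %% n)%N w)
                 (fun l => X ((l + s) %% n).+1 w)]))); last first.
  by apply/seteqP; split=> w /= => [[]|[? [? []]]].
do 3 (apply: measurableI; first exact: measurable_state).
apply: measurable_record_count => u un; first exact: measurable_stateb.
by apply: measurable_partial_sum => l _; exact: increments.1.
Qed.

(** The integral of [cycle_lemma], applied to the bridge continued periodically,
    whose drift over one period is the final value of the walk. *)
Lemma sum_ladder_bridge :
  (\sum_(0 <= s < n) \sum_(1 <= k < n.+1)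
     (k%:R^-1)%:E * P (ladder_bridge s k))%E =
  P [set w | M n w = i /\ 0 < walk X n w].
Proof.
pose A := [set w | M n w = i /\ 0 < walk X n w].
have mA : measurable A.
  apply: measurableI; first exact: measurable_state.
  rewrite -[X in measurable X]setTI.
  have mW : measurable_fun setT (fun w => 0 < walk X n w).
    by apply: measurable_fun_ltr; [exact: measurable_cst|exact: measurable_walk].
  exact: (mW measurableT [set true]).
rewrite -(probability_start mA).
have -> : (\sum_(0 <= s < n) \sum_(1 <= k < n.+1)
     (k%:R^-1)%:E * P (ladder_bridge s k) =
   \sum_(q <- [seq (s, k) | s <- index_iota 0 n, k <- index_iota 1 n.+1])
     (q.2%:R^-1)%:E * P (ladder_bridge q.1 q.2))%E by rewrite big_allpairs.
rewrite -(@integral_sum_indic _ _ _ P _ _ (fun q : nat * nat => q.2%:R^-1)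
  (fun q => ladder_bridge q.1 q.2)); last 2 first.
- by move=> q; rewrite invr_ge0.
- by move=> q; exact: measurable_ladder_bridge.
have mA0 := measurableI _ _ mA (measurable_state 0 i).
rewrite -[X in P X]setIT -integral_indic//; apply: eq_integral => w _.
congr _%:E; rewrite big_allpairs/=.
have [M0|M0] := eqVneq (M 0%N w) i; last first.
  rewrite indicE memNset => [|[_ /= M0']]; last by rewrite M0' eqxx in M0.
  rewrite big1// => s _; rewrite big1// => k _; rewrite indicE memNset ?mulr0//.
  by case=> M0'; rewrite M0' eqxx in M0.
have [Mn|Mn] := eqVneq (M n w) i; last first.
  rewrite indicE memNset => [|[[/= Mn' _] _]]; last by rewrite Mn' eqxx in Mn.
  rewrite big1// => s _; rewrite big1// => k _; rewrite indicE memNset ?mulr0//.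
  by case=> _ Mn'; rewrite Mn' eqxx in Mn.
pose y l := X (l %% n).+1 w.
have yn t : partial_sum y (t + n) = partial_sum y t + partial_sum y n.
  rewrite addnC partial_sum_shift addrC; congr (_ + _).
  by apply: eq_bigr => l _; rewrite /y modnDr.
have Vn t : (M ((t + n) %% n)%N w == i) = (M (t %% n)%N w == i) by rewrite modnDr.
have exV : exists2 s, (s < n)%N & M (s %% n)%N w == i.
  by exists 0%N => //; rewrite mod0n M0.
have := @cycle_lemma _ n (fun t => M (t %% n)%N w == i) (partial_sum y) _ n0 Vn yn exV.
have -> : partial_sum y n = walk X n w.
  by rewrite walk_partial_sum; apply: eq_big_nat => l /andP[_ ln];
    rewrite /y modn_small.
have -> : (0 < walk X n w)%R%:R = \1_(A `&` [set w | M 0%N w = i]) w :> R.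
  rewrite indicE; congr (nat_of_bool _)%:R; apply/idP/idP.
    by move=> W; rewrite inE; split.
  by rewrite inE => -[[]].
move=> <-; apply: eq_big_nat => s /andP[_ sn]; apply: eq_bigr => k _.
congr (_ * _); rewrite indicE; congr (nat_of_bool _)%:R.
have eV : (fun t => M ((s + t) %% n)%N w == i) = (fun t => M ((t + s) %% n)%N w == i).
  by apply/funext => t; rewrite addnC.
have eS : (fun t => partial_sum y (s + t)) =
    (fun t => partial_sum (fun l => X ((l + s) %% n).+1 w) t + partial_sum y s).
  by apply/funext => t; rewrite partial_sum_shift addrC.
rewrite eV eS record_addr nb_records_addr modn_small//; apply/idP/and3P.
  by rewrite inE => -[_ _ Ms [r nr]]; split=> //; apply/eqP.
by case=> /eqP Ms r /eqP nr; rewrite inE; split.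
Qed.

Lemma return_epoch_at_ladder_set k :
  [set w | return_epoch_at_ladder M X i k w = Some n] =
  [set w | record (visit0 M i w) (fun t => walk X t w) n /\
           nb_records (visit0 M i w) (fun t => walk X t w) n = k].
Proof. by apply/seteqP; split=> w /return_epoch_at_ladderP. Qed.

Lemma measurable_return_epoch_at_ladder k :
  measurable [set w | return_epoch_at_ladder M X i k w = Some n].
Proof.
rewrite return_epoch_at_ladder_set.
apply: measurable_record_count => u _; last exact: measurable_walk.
by apply: measurable_or; [exact: measurable_cst|exact: measurable_stateb].
Qed.

(** [bridge_shift] with [Q] the ladder event.  Under the bridge, the visits up to
    time [n] are those of the periodic continuation, time 0 included. *)
Lemma probability_return_epoch_at_ladder k s : (s <= n)%N ->
  P ([set w | return_epoch_at_ladder M X i k w = Some n] `&`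
     [set w | M (n - s)%N w = i]) = P (ladder_bridge s k).
Proof.
move=> sn.
rewrite (bridge_shift start chain increments n0 (measurable_ladder_set k) sn).
rewrite -probability_start; last first.
  apply: measurableI; last exact: measurable_state.
  exact: measurable_return_epoch_at_ladder.
have same w : M 0%N w = i -> M n w = i ->
  [set w | return_epoch_at_ladder M X i k w = Some n] w <->
  ladder_set k (fun l => M (l %% n)%N w) (fun l => X (l %% n).+1 w).
  move=> M0 Mn; rewrite return_epoch_at_ladder_set /=.
  have eV u : (u <= n)%N -> visit0 M i w u = (M (u %% n)%N w == i).
    rewrite leq_eqVlt => /predU1P[->|un].
      by rewrite modnn /visit0 /visit Mn M0 eqxx orbT.
    rewrite modn_small// /visit0 /visit; case: eqP => //= ->.
    by rewrite M0 eqxx.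
  have eS u : (u <= n)%N ->
      walk X u w = partial_sum (fun l => X (l %% n).+1 w) u.
    move=> un; rewrite walk_partial_sum; apply: eq_big_nat => l /andP[_ lu].
    by rewrite modn_small// (leq_trans lu).
  by rewrite (record_ext eV eS) (nb_records_ext eV eS).
congr (P _); apply/seteqP; split=> w /=.
  move=> [[E Ms] M0]; have Mn : M n w = i.
    move/return_epoch_at_ladderP: E => [/andP[V _] _]; apply/eqP.
    by move: V; rewrite /visit0 gtn_eqF.
  by split=> //; exact/same.
by move=> [M0 Mn Ms] E; split=> //; split=> //; exact/(same w).
Qed.

(** The factor sigma(k) counts the visits in (0, n], here written as [n - s]. *)
Lemma expectation_ladder k :
  ('E_P[fun w => (real_of_time (ladder_epoch M X i k w) /
           real_of_time (return_epoch_at_ladder M X i k w) *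
         \1_[set v | return_epoch_at_ladder M X i k v = Some n] w)%R] =
  (n%:R^-1)%:E * \sum_(0 <= s < n) P (ladder_bridge s k))%E.
Proof.
pose E s := [set w | return_epoch_at_ladder M X i k w = Some n] `&`
     [set w | M (n - s)%N w = i].
have mE s : measurable (E s).
  apply: measurableI; last exact: measurable_state.
  exact: measurable_return_epoch_at_ladder.
rewrite ge0_sume_distrr//.
transitivity (\sum_(0 <= s < n) (n%:R^-1)%:E * P (E s))%E; last first.
  apply: eq_big_nat => s /andP[_ sn].
  by rewrite probability_return_epoch_at_ladder// ltnW.
rewrite -(@integral_sum_indic _ _ _ P _ _ (fun=> n%:R^-1))//.
rewrite unlock; apply: eq_integral => w _; congr _%:E.
rewrite [in LHS]indicE.
have [En|En] := eqVneq (return_epoch_at_ladder M X i k w) (Some n); last first.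
  rewrite memNset ?mulr0; last by move=> /= En'; rewrite En' eqxx in En.
  rewrite big1// => s _; rewrite indicE memNset ?mulr0//.
  by case=> /= En'; rewrite En' eqxx in En.
rewrite mem_set// mulr1 (ladder_epochE En) En /= /nb_upto natr_sum mulr_suml.
rewrite big_add1/= big_nat_rev/=; apply: eq_big_nat => s /andP[_ sn].
rewrite add0n mulrC; congr (_ * _); rewrite indicE; congr (nat_of_bool _)%:R.
rewrite /visit -subSn// subSS; apply/eqP/idP => [Ms|].
  by rewrite inE; split.
by rewrite inE => -[].
Qed.

End ladder_formula.

Theorem proposition3p1 (R : realType) (S : countType)
    (d : measure_display) (T : measurableType d)
    (P : S -> probability T R) (p : S -> S -> R) (pi : S -> R)
    (K : S -> S -> probability (measurableTypeR R) R)
    (M : nat -> T -> S) (X : nat -> T -> R)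
    (hMRW : markov_random_walk P p K M X)
    (hrec : positive_recurrent P M)
    (hpi : unique_stationary_distribution p pi)
    (i : S) (n : nat) :
  P i [set w | M n w = i /\ 0 < walk X n w] =
  (\sum_(1 <= k <oo)
     (n%:R / k%:R)%:E *
     'E_(P i)[fun w =>
        (real_of_time (ladder_epoch M X i k w) /
           real_of_time (return_epoch_at_ladder M X i k w) *
         \1_[set v | return_epoch_at_ladder M X i k v = Some n] w)%R])%E.
Proof.
have [n0|] := posnP n.
  rewrite n0 (_ : [set w | _] = set0) ?measure0; last first.
    by apply/seteqP; split=> // w [_]; rewrite /walk big_geq// ltxx.
  by rewrite eseries0// => k _ _; rewrite mul0r mul0e.
move=> n0; have start := mrw_start hMRW i; have chain := mrw_chain hMRW i.
have incr := mrw_increments hMRW i.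
(* The k-th term is 1/k times a finite sum, and it vanishes for k > n because a
   bridge of length n has at most n records. *)
pose LB := ladder_bridge M X i n.
have term k : ((n%:R / k%:R)%:E * 'E_(P i)[fun w =>
        (real_of_time (ladder_epoch M X i k w) /
           real_of_time (return_epoch_at_ladder M X i k w) *
         \1_[set v | return_epoch_at_ladder M X i k v = Some n] w)%R] =
    (k%:R^-1)%:E * \sum_(0 <= s < n) P i (LB s k))%E.
  rewrite (expectation_ladder start chain incr n0) muleA -EFinM.
  by rewrite mulrAC divff ?mul1r// pnatr_eq0 -lt0n.
under eq_eseriesr do rewrite term.
rewrite (nneseries_split 1 n); last first.
  by move=> k _; apply: mule_ge0; rewrite ?lee_fin ?invr_ge0// sume_ge0.
rewrite [X in (_ + X)%E]eseries0 ?adde0; last first.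
  move=> k nk _; rewrite big1 ?mule0// => s _.
  rewrite (_ : LB s k = set0) ?measure0//; apply/seteqP; split=> // w [_ _ _ [_ nk']].
  have := nb_upto_le (record (fun t => M ((t + s) %% n)%N w == i)
    (partial_sum (fun l => X ((l + s) %% n).+1 w))) n.
  by rewrite -/(nb_records _ _ _) nk' leqNgt -add1n nk.
rewrite -(sum_ladder_bridge start chain incr n0) exchange_big/= add1n.
by apply: eq_bigr => k _; rewrite ge0_sume_distrr.
Qed.
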